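(* Let $T$ be a tree on $n\ge 2$ vertices with normalized Laplacian matrix $\mathcal{L}$, with second smallest eigenvalue $\lambda_1$, and let $i$ and $j$ be adjacent vertices of $T$. Let $M_1$ be the normalized bottleneck matrix for the branch at $j$ containing $i$ and $D_1$ the degree matrix of this branch; let $M_2$ be the normalized bottleneck matrix for the branch at $i$ containing $j$ and $D_2$ the degree matrix of this branch. Then $T$ is a Type 2 tree with characteristic vertices $i$ and $j$ if and only if there exists $\gamma\in(0,1)$ such that $$\rho\bigl(M_1-\gamma D_1^{1/2}\mathbf{1}\mathbf{1}^{T}D_1^{1/2}\bigr)=\rho\bigl(M_2-(1-\gamma)D_2^{1/2}\mathbf{1}\mathbf{1}^{T}D_2^{1/2}\bigr)=\frac{1}{\lambda_1}.$$
   Context: For a tree $T$ on $n\ge 2$ vertices, $d_u$ is the degree of $u$ in $T$, and the normalized Laplacian matrix is the $n\times n$ matrix $\mathcal{L}=\mathcal{L}(T)$ with entries $\mathcal{L}(u,u)=1$, $\mathcal{L}(u,w)=-1/\sqrt{d_u d_w}$ if $u,w$ are adjacent, and $0$ otherwise. Its eigenvalues are $0=\lambda_0\le\lambda_1\le\dots\le\lambda_{n-1}$; an eigenfunction of $\lambda$ is a nonzero real vector $g$ indexed by the vertices with $\mathcal{L}g=\lambda g$. $\rho$ denotes the spectral radius and $\mathbf{1}$ the all-ones column vector of appropriate size (superscript $T$ on a vector is transpose). Let $g$ be an eigenfunction of $\lambda_1$. The blocks of a tree are its edges (pairs of adjacent vertices); a block is mixed if $g$ is positive at one of its vertices and negative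 at the other. $T$ is a Type 2 tree if there is a unique mixed block; the two adjacent vertices $i,j$ of that block (those with $\operatorname{sign}(g(i))\neq\operatorname{sign}(g(j))$) are the characteristic vertices of $T$. A branch of $T$ at a vertex $k$ is a connected component of $T-k$. Let $\mathcal{L}_k$ be the principal submatrix of $\mathcal{L}$ obtained by deleting the row and column of $k$. The normalized bottleneck matrix of a branch $C$ at $k$ is the diagonal block of $\mathcal{L}_k^{-1}$ corresponding to $C$ (equivalently, the inverse of the principal submatrix of $\mathcal{L}$ indexed by the vertices of $C$). The degree matrix of a branch is the diagonal matrix whose entries are the degrees, in $T$, of the vertices of the branch. *)

(* Defs.v *)
From mathcomp Require Import all_boot all_order all_algebra.
From mathcomp Require Import polyorder polyrcf complex.
From mathcomp Require Import classical_sets reals.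

Set Implicit Arguments.
Unset Strict Implicit.
Unset Printing Implicit Defensive.

Import Order.TTheory GRing.Theory Num.Theory.
Local Open Scope ring_scope.

Section Trees.
Variables (n : nat) (e : rel 'I_n).

(* [cycle e] alone also accepts the back-and-forth walk u, v along an edge, *)
(* hence the length condition.                                              *)
Definition is_tree : Prop :=
  [/\ symmetric e, irreflexive e, (forall u v, connect e u v)
    & forall p : seq 'I_n, (2 < size p)%N -> ~~ (cycle e p && uniq p)].

Definition deg (u : 'I_n) : nat := #|[set w | e u w]|.

Definition del_vertex (k : 'I_n) : rel 'I_n :=
  [rel u w | [&& e u w, u != k & w != k]].

(* The branch at k containing u, for u != k. *)
Definition branch (k u : 'I_n) : {set 'I_n} :=
  [set w | connect (del_vertex k) u w].

Definition blocks : {set {set 'I_n}} :=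
  [set [set p.1; p.2] | p : 'I_n * 'I_n & e p.1 p.2].

End Trees.

Section Spectra.
Variable R : realType.

(* The real eigenvalues in nondecreasing order, each repeated according to *)
(* its multiplicity as a root of the characteristic polynomial; for a      *)
(* symmetric matrix these are all the eigenvalues.                         *)
Definition spectrum n (A : 'M[R]_n) : seq R :=
  flatten [seq nseq (\mu_x (char_poly A)) x | x <- rootsR (char_poly A)].

(* The maximal modulus of a complex eigenvalue (a maximum when n > 0). *)
Definition spectral_radius n (A : 'M[R]_n) : R :=
  sup [set r | exists2 z : complex R,
         eigenvalue (map_mx (real_complex R) A) z & r = Normc.normc z]%classic.

Definition eigenfunction n (A : 'M[R]_n) (a : R) (g : 'cV[R]_n) : Prop :=
  g != 0 /\ A *m g = a *: g.

(* The principal square root of a nonnegative diagonal matrix D. *)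
Definition sqrt_diag n (D : 'M[R]_n) : 'M[R]_n := map_mx Num.sqrt D.

End Spectra.

Section NormalizedLaplacian.
Variables (R : realType) (n : nat) (e : rel 'I_n).

Definition nlaplacian : 'M[R]_n :=
  \matrix_(u, w) if u == w then 1
                 else if e u w then - (Num.sqrt ((deg e u)%:R * (deg e w)%:R))^-1
                 else 0.

(* Eigenvalues are numbered from 0. *)
Definition lambda1 : R := (spectrum nlaplacian)`_1.

(* The diagonal block, on the vertices of C, of the inverse of the Laplacian *)
(* with row and column k deleted. [lift k] identifies the indices of the     *)
(* deleted matrix with the vertices other than k and [unlift k] is its       *)
(* partial inverse; the default value 0 is unused when C avoids k.           *)
Definition bottleneck (k : 'I_n) (C : {set 'I_n}) : 'M[R]_#|C| :=
  \matrix_(a, b)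
    if (unlift k (enum_val a), unlift k (enum_val b)) is (Some u, Some w)
    then invmx (row' k (col' k nlaplacian)) u w else 0.

(* Degrees are taken in the whole tree, not in the subgraph induced by C. *)
Definition degree_mx (C : {set 'I_n}) : 'M[R]_#|C| :=
  diag_mx (\row_a (deg e (enum_val a))%:R).

Definition mixed (g : 'cV[R]_n) (B : {set 'I_n}) : Prop :=
  exists u w, [/\ u \in B, w \in B, 0 < g u 0 & g w 0 < 0].

(* g is meant to be an eigenfunction of lambda1. *)
Definition type2 (g : 'cV[R]_n) : Prop :=
  exists! B, B \in blocks e /\ mixed g B.

Definition characteristic_vertices (g : 'cV[R]_n) (i j : 'I_n) : Prop :=
  [set i; j] \in blocks e /\ mixed g [set i; j].

End NormalizedLaplacian.

(* Main.v *)
Require Import Defs.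
From mathcomp Require Import all_boot all_order all_algebra.
From mathcomp Require Import polyorder polyrcf complex spectral sesquilinear.
From mathcomp Require Import classical_sets reals.
From mathcomp Require Import ring lra.

Set Implicit Arguments.
Unset Strict Implicit.
Unset Printing Implicit Defensive.

Import Order.TTheory GRing.Theory Num.Theory.
Local Open Scope ring_scope.

(** Write L for the normalized Laplacian, w for the vector of the square roots
of the degrees (so that L w = 0), C for the branch at j that contains i, and
restrict vectors and matrices to C.

The matrix in the theorem is the inverse of a small perturbation of a principal
submatrix of L: by the Sherman-Morrison formula, and since L[C] w = e_i / w_i,
    M - gamma w w^T = (L[C] + t e_i e_i^T)^-1,  t = gamma / ((1 - gamma) w_i^2)
([perturbed_bottleneckE]). This K(t) = L[C] + t e_i e_i^T is symmetric positive
definite, so the spectral radius of its inverse is 1 / lambda exactly when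
lambda is the least eigenvalue of K(t) ([spectral_radius_invmx] and
[spectral_radius_invmx_inv]). Moreover ij is the only edge that leaves C, so
an eigenvector g of L for lambda satisfies on C
    K(t) g = lambda g + (t g_i - L_ij g_j) e_i          ([branch_matrix_eigen]).
Hence g is an eigenvector of K(t) as soon as t g_i = L_ij g_j, and because the
off-diagonal entries of K(t) are nonpositive and C is connected, Perron-Frobenius
theory says that the eigenvectors of the least eigenvalue are those of constant
strict sign.

If g changes sign along ij, the equations t g_i = L_ij g_j and
t' g_j = L_ij g_i have a common solution gamma in (0, 1), where t' is given by
1 - gamma and the degree of j. The restrictions of g are then eigenvectors; they
have constant sign because an eigenvector of lambda_1 that changes sign along an
edge of a tree changes sign nowhere else ([fiedler_sign]). So lambda_1 is the
least eigenvalue on both sides ([branch_radius]).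

Conversely, suppose that lambda_1 is the least eigenvalue on both sides. Pairing
the displayed equation with a positive eigenvector of K(t) makes its last term
vanish, so t g_i = L_ij g_j with t > 0 > L_ij, and g has a constant strict sign
on each branch, unless it vanishes there ([branch_radius_inv]). As g is not zero,
it has opposite signs on the two branches, and only ij joins them.

Positivity comes everywhere from one identity ([reweighted_energy]): if A y = la y
and x is y reweighted by c, then
    x^T A x - la x^T x = - 1/2 sum_(a,b) A_ab y_a y_b (c_a - c_b)^2. *)

(** * Quadratic forms of real matrices *)

Section Dot.
Variables (R : realType) (n : nat).
Implicit Types (x y z : 'cV[R]_n) (A : 'M[R]_n) (la : R).

Definition dot x y : R := \sum_u x u 0 * y u 0.

Lemma dotC x y : dot x y = dot y x.
Proof. by apply: eq_bigr => u _; rewrite mulrC. Qed.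

Lemma dotDl x y z : dot (x + y) z = dot x z + dot y z.
Proof. by rewrite -big_split; apply: eq_bigr => u _; rewrite mxE mulrDl. Qed.

Lemma dotZl a x y : dot (a *: x) y = a * dot x y.
Proof. by rewrite mulr_sumr; apply: eq_bigr => u _; rewrite mxE mulrA. Qed.

Lemma dotDr x y z : dot x (y + z) = dot x y + dot x z.
Proof. by rewrite !(dotC x) dotDl. Qed.

Lemma dotZr a x y : dot x (a *: y) = a * dot x y.
Proof. by rewrite !(dotC x) dotZl. Qed.

Lemma dotE x y : dot x y = (x^T *m y) 0 0.
Proof. by rewrite mxE; apply: eq_bigr => u _; rewrite mxE. Qed.

Lemma dot_ge0 x : 0 <= dot x x.
Proof. by apply: sumr_ge0 => u _; rewrite -expr2 sqr_ge0. Qed.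

Lemma dot_eq0 x : dot x x = 0 -> x = 0.
Proof.
move/eqP; rewrite psumr_eq0 => [/allP x0|u _]; last by rewrite -expr2 sqr_ge0.
apply/colP => u; rewrite mxE; apply/eqP.
by have := x0 u (mem_index_enum _); rewrite mulf_eq0 orbb.
Qed.

Lemma dot_gt0 x : x != 0 -> 0 < dot x x.
Proof.
by move=> x0; rewrite lt0r dot_ge0 andbT; apply: contraNneq x0 => /dot_eq0->.
Qed.

Lemma dot_sym A x y : A^T = A -> dot x (A *m y) = dot (A *m x) y.
Proof. by move=> sA; rewrite !dotE trmx_mul sA mulmxA. Qed.

Definition form_ge A la := forall x, la * dot x x <= dot x (A *m x).

(** An isotropic vector of a positive semidefinite form minimizes it, so the
first variation at this vector vanishes in every direction. *)
Lemma form_ge_kernel A la y :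
  A^T = A -> form_ge A la -> dot y (A *m y) = la * dot y y -> A *m y = la *: y.
Proof.
move=> sA Age Ey; set r := A *m y - la *: y.
suff /eqP : r = 0 by rewrite subr_eq0 => /eqP.
apply: dot_eq0; apply/eqP; rewrite eq_le dot_ge0 andbT leNgt; apply/negP => r0.
set q := dot r (A *m r) - la * dot r r.
have q0 : 0 <= q by rewrite subr_ge0.
have Er : dot r r = dot r (A *m y) - la * dot r y.
  by rewrite {2}/r dotDr -scaleN1r dotZr dotZr; ring.
clearbody r.
(* In the direction - r the form decreases to first order at the rate 2 |r|^2; a
   step of length |r|^2 / (q + 1) is too short for the quadratic term q to
   compensate. *)
have := Age (y - (dot r r / (q + 1)) *: r).
set t := dot r r / (q + 1).
rewrite mulmxBr -scalemxAr -!scaleNr !(dotDl, dotDr, dotZl, dotZr) Ey.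
have -> : dot y (A *m r) = dot r (A *m y) by rewrite dot_sym // dotC.
rewrite (dotC y r).
have -> : dot r (A *m r) = q + la * dot r r by rewrite /q; ring.
have -> : dot r (A *m y) = dot r r + la * dot r y by rewrite Er; ring.
have Et : t * (q + 1) = dot r r by rewrite /t divfK // gt_eqF // ltr_wpDl.
have t0 : 0 < t by rewrite /t divr_gt0 // ltr_wpDl.
have : t * (t * q) < t * dot r r.
  by rewrite ltr_pM2l // -Et ltr_pM2l // ltrDl.
have : 0 < t * dot r r by exact: mulr_gt0.
rewrite -/t; nra.
Qed.

End Dot.

(** * Perron-Frobenius theory of symmetric matrices *)

(** For properties that edges propagate in the forward direction only. *)
Lemma connect_ind (T : finType) (r : rel T) (P : T -> Prop) x y :
  (forall u v, P u -> r u v -> P v) -> P x -> connect r x y -> P y.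
Proof.
move=> Pr Px /connectP[p pth ->].
by elim: p x Px pth => //= z p IHp x Px /andP[/(Pr _ _ Px) Pz /IHp]; apply.
Qed.

Section Perron.
Variables (R : realType) (n : nat).
Implicit Types (x y : 'cV[R]_n) (A : 'M[R]_n) (la : R).

Definition offdiag_le0 A := forall a b, a != b -> A a b <= 0.

(** Irreducibility of a matrix with nonpositive off-diagonal entries, in the form
in which it is used: negative entries transport zeros and equalities. *)
Definition irreducible A := forall a b, connect [rel a b | A a b < 0] a b.

(** Expand the square: the two square terms give la * dot x x by the
eigenvector equation, and the cross terms give the quadratic form. For
positive y this is the ground state representation of the form; for an
eigenvector y that changes sign, weights that are constant on large sets give
test vectors of low energy. *)
Lemma reweighted_energy A la y (c : 'I_n -> R) (x := \col_a (c a * y a 0)) :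
  A^T = A -> A *m y = la *: y ->
  \sum_a \sum_b - A a b * (y a 0 * y b 0) * (c a - c b) ^+ 2
  = (dot x (A *m x) - la * dot x x) *+ 2.
Proof.
move=> sA Ay.
have Ayx : \sum_a \sum_b A a b * (y a 0 * y b 0) * c a ^+ 2 = la * dot x x.
  rewrite mulr_sumr; apply: eq_bigr => a _; rewrite mxE.
  transitivity (c a ^+ 2 * y a 0 * (A *m y) a 0).
    by rewrite mxE mulr_sumr; apply: eq_bigr => b _; ring.
  by rewrite Ay mxE; ring.
have Ayx' : \sum_a \sum_b A a b * (y a 0 * y b 0) * c b ^+ 2 = la * dot x x.
  rewrite exchange_big -Ayx; apply: eq_bigr => a _; apply: eq_bigr => b _.
  by rewrite -{1}sA mxE; ring.
have Axx : \sum_a \sum_b A a b * x a 0 * x b 0 = dot x (A *m x).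
  apply: eq_bigr => a _; rewrite [(A *m x) a 0]mxE mulr_sumr.
  by apply: eq_bigr => b _; ring.
rewrite mulrnBl -{1}Axx [_ *+ 2 in X in _ - X]mulr2n -{1}Ayx -Ayx'.
rewrite -sumrMnl -big_split -sumrB; apply: eq_bigr => a _.
rewrite -sumrMnl -big_split -sumrB; apply: eq_bigr => b _ /=.
by rewrite !mxE; ring.
Qed.

Lemma ground_state_energy A la y x :
  A^T = A -> offdiag_le0 A -> (forall a, 0 < y a 0) -> A *m y = la *: y ->
  let T a b :=
    - A a b * (y a 0 * y b 0) * (x a 0 / y a 0 - x b 0 / y b 0) ^+ 2 in
  (forall a b, 0 <= T a b) /\
  \sum_a \sum_b T a b = (dot x (A *m x) - la * dot x x) *+ 2.
Proof.
move=> sA oA y0 Ay T; split=> [a b|].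
  rewrite /T; have [->|ab] := eqVneq a b; first by rewrite subrr expr0n mulr0.
  by rewrite mulr_ge0 ?sqr_ge0 // mulr_ge0 ?oppr_ge0 ?oA // mulr_ge0 // ltW.
have xE : x = \col_a (x a 0 / y a 0 * y a 0).
  by apply/colP => a; rewrite mxE divfK // gt_eqF.
by rewrite {1 2 3 4}xE -reweighted_energy.
Qed.

(** A positive eigenvector belongs to the least eigenvalue. *)
Lemma ground_state_ge A la y :
  A^T = A -> offdiag_le0 A -> (forall a, 0 < y a 0) -> A *m y = la *: y ->
  form_ge A la.
Proof.
move=> sA oA y0 Ay x; have [T0 ET] := ground_state_energy x sA oA y0 Ay.
rewrite -subr_ge0 -(pmulrn_lge0 _ (isT : 0 < 2)%N) -ET.
by apply: sumr_ge0 => a _; apply: sumr_ge0.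
Qed.

Lemma ground_state_unique A la x y :
  A^T = A -> offdiag_le0 A -> irreducible A -> (forall a, 0 < y a 0) ->
  A *m y = la *: y -> dot x (A *m x) = la * dot x x ->
  forall a b, x a 0 / y a 0 = x b 0 / y b 0.
Proof.
move=> sA oA iA y0 Ay Ex a b.
have [T0 /eqP] := ground_state_energy x sA oA y0 Ay.
rewrite Ex subrr mul0rn psumr_eq0 => [/allP z0|c _]; last exact: sumr_ge0.
apply: (connect_ind (P := fun b => x a 0 / y a 0 = x b 0 / y b 0) _ _ (iA a b)).
  move=> c d -> /= Acd; have := z0 c (mem_index_enum _).
  rewrite psumr_eq0 // => /allP /(_ d (mem_index_enum _)) /=.
  rewrite mulf_eq0 sqrf_eq0 subr_eq0 => /orP[|/eqP //].
  by rewrite !mulf_eq0 oppr_eq0 lt_eqF //= !gt_eqF.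
by [].
Qed.

(** At a zero of y all the terms of the eigenvector equation are nonpositive, so
the neighbours are zeros too. *)
Lemma nonneg_eigenvector_gt0 A la y :
  offdiag_le0 A -> irreducible A -> A *m y = la *: y ->
  (forall a, 0 <= y a 0) -> y != 0 -> forall a, 0 < y a 0.
Proof.
move=> oA iA Ay y0 yN0 a; rewrite lt0r y0 andbT.
apply: contraNneq yN0 => ya0; apply/eqP/colP => b; rewrite mxE.
apply: (connect_ind (P := fun b => y b 0 = 0) _ _ (iA a b)) => //.
move=> c d yc /= Acd.
have := congr1 (fun z : 'cV_n => z c 0) Ay; rewrite !mxE yc mulr0 => /eqP.
rewrite -oppr_eq0 -sumrN psumr_eq0 => [/allP/(_ d (mem_index_enum _))|k _] /=.
  by rewrite oppr_eq0 mulf_eq0 lt_eqF //= => /eqP.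
have [<-|kc] := eqVneq c k; first by rewrite yc mulr0 oppr0.
by rewrite -mulNr mulr_ge0 // oppr_ge0 oA.
Qed.

(** Replacing y by its absolute value does not increase the energy, so the
absolute value z lies in the kernel too, and so does z - y. Both are
nonnegative, hence each of them is positive or zero. *)
Lemma perron_kernel A la y :
  A^T = A -> offdiag_le0 A -> irreducible A -> form_ge A la ->
  A *m y = la *: y ->
  [\/ y = 0, forall a, 0 < y a 0 | forall a, y a 0 < 0].
Proof.
move=> sA oA iA Age Ay.
pose z : 'cV_n := \col_a `|y a 0|.
have Az : A *m z = la *: z.
  apply: form_ge_kernel => //; apply/eqP; rewrite eq_le Age andbT.
  have -> : dot z z = dot y y.
    by apply: eq_bigr => a _; rewrite !mxE -normrM ger0_norm // -expr2 sqr_ge0.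
  rewrite -dotZr -Ay; apply: ler_sum => a _; rewrite !mxE !mulr_sumr.
  apply: ler_sum => b _; rewrite mxE.
  have [->|ab] := eqVneq a b.
    by rewrite mulrCA [leRHS]mulrCA -normrM ger0_norm // -expr2 sqr_ge0.
  rewrite mulrCA [leRHS]mulrCA -normrM; apply: ler_wnM2l; first exact: oA.
  exact: ler_norm.
have [->|yN0] := eqVneq y 0; first by constructor 1.
have [/eqP zy|zy] := eqVneq (z - y) 0.
  constructor 2 => a; have /colP/(_ a) : z = y by apply/eqP; rewrite -subr_eq0.
  move=> <-; apply: (nonneg_eigenvector_gt0 oA iA Az) => [b|].
    by rewrite mxE.
  by rewrite subr_eq0 in zy; rewrite (eqP zy).
have zy0 : forall a, 0 < (z - y) a 0.
  apply: (nonneg_eigenvector_gt0 oA iA _ _ zy) => [|b].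
    by rewrite mulmxBr Az Ay -scalerBr.
  by rewrite !mxE subr_ge0 ler_norm.
constructor 3 => a; have := zy0 a; rewrite !mxE subr_gt0 ltNge.
by apply: contraNlt => /ger0_norm->.
Qed.

End Perron.

(** * Spectra of real symmetric matrices *)

Lemma flatten_nseq_sorted (R : realType) (k : R -> nat) (s : seq R) :
  sorted <%R s -> sorted <=%R (flatten [seq nseq (k x) x | x <- s]).
Proof.
rewrite lt_sorted_pairwise le_sorted_pairwise.
elim: s => //= x s IHs /andP[/allP xs /IHs {}IHs].
rewrite pairwise_cat IHs andbT; apply/andP; split.
  apply/allrelP => a b /nseqP[-> _] /flatten_mapP[c cs /nseqP[-> _]].
  by rewrite ltW ?xs.
by elim: (k x) => //= l ->; rewrite andbT; apply/allP => a /nseqP[->].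
Qed.

Lemma unitmx_col_kernel (F : fieldType) n (A : 'M[F]_n) :
  (forall x : 'cV_n, A *m x = 0 -> x = 0) -> A \in unitmx.
Proof.
move=> Ainj; rewrite -unitmx_tr -row_free_unit -kermx_eq0.
apply/rowV0P => v /sub_kermxP vA; apply: trmx_inj; rewrite trmx0.
by apply: Ainj; rewrite -[A]trmxK -trmx_mul vA trmx0.
Qed.

Section SymmetricSpectrum.
Variables (R : realType) (n : nat).
Implicit Types (x y : 'cV[R]_n) (A K : 'M[R]_n) (la : R).
Local Notation toC := (real_complex R).

Lemma eigenvalue_col A la y :
  A^T = A -> y != 0 -> A *m y = la *: y -> eigenvalue A la.
Proof.
move=> sA y0 Ay; apply/eigenvalueP; exists y^T; last by rewrite trmx_eq0.
by rewrite -[A]sA -trmx_mul Ay linearZ.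
Qed.

(** The real and imaginary parts a, b of a complex eigenvector for p + iq span a
real invariant plane, and symmetry of A on the pair (a, b) forces
q (|a|^2 + |b|^2) = 0. *)
Lemma sym_eigenvalue_real A (z : complex R) :
  A^T = A -> eigenvalue (map_mx toC A) z ->
  z = toC (complex.Re z) /\
  exists2 y : 'cV[R]_n, y != 0 & A *m y = complex.Re z *: y.
Proof.
move=> sA /eigenvalueP[v Av v0].
pose a : 'cV[R]_n := \col_u complex.Re (v 0 u).
pose b : 'cV[R]_n := \col_u complex.Im (v 0 u).
have vE u : v 0 u = (a u 0 +i* b u 0)%C by rewrite !mxE; case: (v 0 u).
case: z Av => p q Av.
have AvE u : ((\sum_w A u w * a w 0) +i* (\sum_w A u w * b w 0))%C
           = ((p +i* q) * (a u 0 +i* b u 0))%C.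
  have := congr1 (fun r : 'rV_n => r 0 u) Av; rewrite !mxE vE => <-.
  elim: index_enum => [|w s IHs]; first by rewrite !big_nil.
  rewrite !big_cons -IHs vE [(map_mx _ _) _ _]mxE.
  have -> : A w u = A u w by rewrite -[in LHS]sA mxE.
  by apply/eqP; rewrite eq_complex /=; apply/andP; split; apply/eqP; ring.
have Aa : A *m a = p *: a - q *: b.
  by apply/colP => u; have [E _] := AvE u; rewrite mxE E !mxE.
have Ab : A *m b = p *: b + q *: a.
  by apply/colP => u; have [_ E] := AvE u; rewrite mxE E !mxE.
have ab0 : (a != 0) || (b != 0).
  rewrite -negb_and; apply: contra v0 => /andP[/eqP a0 /eqP b0].
  by apply/eqP/rowP => u; rewrite vE a0 b0 !mxE.
have q0 : q = 0.
  have := dot_sym a b sA.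
  rewrite Aa Ab -scaleNr !(dotDl, dotDr, dotZl, dotZr) => /eqP.
  rewrite -subr_eq0.
  have -> : p * dot a b + q * dot a a - (p * dot a b + - q * dot b b)
          = q * (dot a a + dot b b) by ring.
  rewrite mulf_eq0 => /orP[/eqP //|].
  rewrite paddr_eq0 ?dot_ge0 // => /andP[/eqP/dot_eq0 a0 /eqP/dot_eq0 b0].
  by rewrite a0 b0 eqxx in ab0.
rewrite q0; split=> //.
rewrite q0 scale0r subr0 in Aa; rewrite q0 scale0r addr0 in Ab.
by case/orP: ab0 => [?|?]; [exists a | exists b].
Qed.

(** Rayleigh principle, read off a unitary diagonalization over the complex
numbers. *)
Lemma min_eigenvalue A : A^T = A -> (0 < n)%N ->
  exists m (y : 'cV[R]_n), [/\ y != 0, A *m y = m *: y & form_ge A m].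
Proof.
move=> sA n0; pose Ac := map_mx toC A.
have Anormal : Ac \is normalmx.
  apply: symmetric_normalmx.
    by apply/is_hermitianmxP; rewrite expr0 scale1r map_mx_id // map_trmx sA.
  apply/mxOverP => u w; rewrite mxE; apply/complex_realP; by exists (A u w).
have Adiag := orthomx_spectralP Anormal.
move: (spectral_unitarymx Ac) Adiag.
move: (spectralmx Ac) (spectral_diag Ac) => P sp Pun Adiag.
have Punit := unitarymx_unit Pun.
have spP k : eigenvalue Ac (sp 0 k).
  apply/eigenvalueP; exists (row k P).
    rewrite Adiag -row_mul !mulmxA mulmxV // mul1mx row_mul row_diag_mx.
    by rewrite -scalemxAl -rowE.
  apply/negP => /eqP; rewrite rowE => /(congr1 (mulmx^~ (invmx P))).
  rewrite mulmxK // mul0mx => /rowP/(_ k)/eqP.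
  by rewrite !mxE !eqxx oner_eq0.
pose m k := complex.Re (sp 0 k).
have spE k : sp 0 k = toC (m k) by have [] := sym_eigenvalue_real sA (spP k).
pose k := [arg min_(k < Ordinal n0) m k]%O.
have mk l : m k <= m l by rewrite /k; case: arg_minP => // ? _; apply.
have [_ [y y0 Ay]] := sym_eigenvalue_real sA (spP k).
exists (m k), y; split=> // x.
pose xc : 'cV_n := map_mx toC x.
pose z : 'cV_n := P *m xc.
have xP : xc^T *m invmx P = map_mx Num.conj z^T.
  rewrite invmx_unitary // /z trmx_mul map_mxM; congr (_ *m _).
  apply/matrixP => u w; rewrite !mxE.
  by apply/esym/CrealP/complex_realP; exists (x w u).
have Exx : toC (dot x x) = \sum_l `|z l 0| ^+ 2.
  transitivity ((xc^T *m xc) 0 0).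
    by rewrite dotE /xc map_trmx -map_mxM [RHS]mxE.
  rewrite -[X in _ *m X](mulKmx Punit) !mulmxA xP -mulmxA mxE.
  by apply: eq_bigr => l _; rewrite !mxE normCKC.
have ExAx : toC (dot x (A *m x)) = \sum_l sp 0 l * `|z l 0| ^+ 2.
  transitivity ((xc^T *m Ac *m xc) 0 0).
    by rewrite dotE /xc map_trmx -!map_mxM [RHS]mxE mulmxA.
  rewrite Adiag !mulmxA xP -mulmxA mxE.
  apply: eq_bigr => l _; rewrite mul_mx_diag !mxE normCKC; ring.
rewrite -lecR rmorphM /= Exx ExAx mulr_sumr; apply: ler_sum => l _.
by rewrite spE ler_wpM2r ?exprn_ge0 // lecR.
Qed.

(** The spectrum is listed in nondecreasing order, and m exceeds another entry of
it, so m occurs at a positive index. *)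
Lemma second_eigenvalue_le A a m :
  eigenvalue A a -> eigenvalue A m -> a < m -> (spectrum A)`_1 <= m.
Proof.
have mem_spectrum b : eigenvalue A b -> b \in spectrum A.
  rewrite eigenvalue_root_char => pb.
  have p0 : char_poly A != 0 by rewrite monic_neq0 ?char_poly_monic.
  apply/flatten_mapP; exists b; last by rewrite mem_nseq eqxx mu_gt0 // pb.
  by rewrite -(roots_on_rootsR p0) pb.
move=> /mem_spectrum a_sp /mem_spectrum m_sp am.
have sp_le := sorted_leq_nth le_trans lexx 0
  (flatten_nseq_sorted _ (sorted_roots _ _ (char_poly A))).
rewrite -/(rootsR _) -/(spectrum A) in sp_le.
have m1 : (0 < index m (spectrum A))%N.
  rewrite lt0n; apply: contraTneq am => m0; rewrite -leNgt.
  rewrite -(nth_index 0 a_sp) -(nth_index 0 m_sp) m0.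
  by apply: sp_le; rewrite ?inE ?index_mem // -m0 index_mem.
rewrite -[leRHS](nth_index 0 m_sp); apply: sp_le; rewrite ?inE ?index_mem //.
by apply: leq_ltn_trans m1 _; rewrite index_mem.
Qed.

(** An eigenvalue p of the inverse is real and has 1 / p as an eigenvalue of K,
so 0 < p <= 1 / m. *)
Lemma spectral_radius_invmx K m y :
  K^T = K -> 0 < m -> form_ge K m -> y != 0 -> K *m y = m *: y ->
  spectral_radius (invmx K) = m^-1.
Proof.
move=> sK m0 Kge y0 Ky.
have Ku : K \in unitmx.
  apply: unitmx_col_kernel => x Kx; apply: dot_eq0; apply/eqP.
  have := Kge x; rewrite Kx -[X in _ <= dot x X](scale0r x) dotZr mul0r.
  by rewrite pmulr_rle0 // eq_le dot_ge0 andbT.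
have sN : (invmx K)^T = invmx K by rewrite trmx_inv sK.
rewrite /spectral_radius; set S := (X in sup X).
have Sm : S m^-1.
  exists (toC m^-1); last first.
    by rewrite /Normc.normc /= expr0n addr0 sqrtr_sqr gtr0_norm ?invr_gt0.
  have /eigenvalueP[v Nv v0] : eigenvalue (invmx K) m^-1.
    apply: (eigenvalue_col sN y0).
    by rewrite -[y in LHS](scalerK (lt0r_neq0 m0)) -Ky -scalemxAr mulKmx.
  apply/eigenvalueP; exists (map_mx toC v).
    by rewrite -map_mxM Nv map_mxZ.
  by rewrite map_mx_eq0.
have Sub : ubound S m^-1.
  move=> r [z /(sym_eigenvalue_real sN)[-> [x x0 Nx]] ->].
  move: (complex.Re z) Nx => p Nx.
  have xE : x = p *: (K *m x) by rewrite scalemxAr -Nx mulKVmx.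
  have xx : dot x x = p * dot x (K *m x) by rewrite {2}xE dotZr.
  have x_gt0 := dot_gt0 x0.
  have Kx_gt0 : 0 < dot x (K *m x).
    by apply: lt_le_trans (Kge x); rewrite mulr_gt0.
  have p0 : 0 < p by rewrite -(pmulr_lgt0 _ Kx_gt0) -xx.
  rewrite /Normc.normc /= expr0n addr0 sqrtr_sqr gtr0_norm //.
  rewrite -(ler_pM2r Kx_gt0) -xx ler_pdivlMl //.
apply/eqP; rewrite eq_le ge_sup //=; last by exists m^-1.
by apply: ub_le_sup => //; exists m^-1.
Qed.

(** Converse of the preceding lemma: K has some least eigenvalue, whose
inverse must be the given radius. *)
Lemma spectral_radius_invmx_inv K la :
  (0 < n)%N -> K^T = K -> (forall x, x != 0 -> 0 < dot x (K *m x)) ->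
  spectral_radius (invmx K) = la^-1 ->
  form_ge K la /\ exists2 y : 'cV[R]_n, y != 0 & K *m y = la *: y.
Proof.
move=> n0 sK Kpos; have [m [y [y0 Ky Kge]]] := min_eigenvalue sK n0.
have m0 : 0 < m.
  by have := Kpos y y0; rewrite Ky dotZr pmulr_lgt0 // dot_gt0.
rewrite (spectral_radius_invmx sK m0 Kge y0 Ky) => /invr_inj <-.
by split=> //; exists y.
Qed.

End SymmetricSpectrum.

(** * The two branches at an edge of a tree *)

Section TreeEdge.
Variables (n : nat) (e : rel 'I_n).
Hypothesis treeT : is_tree e.

Lemma edge_sym u v : e u v = e v u.
Proof. by case: treeT => ->. Qed.

Lemma edge_neq u v : e u v -> u != v.
Proof. by case: treeT => _ irr _ _; apply: contraTneq => ->; rewrite irr. Qed.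

Lemma branch_root k u : u \in branch e k u.
Proof. by rewrite inE connect0. Qed.

Lemma branch_avoid k u v : u != k -> v \in branch e k u -> v != k.
Proof.
rewrite inE => uk; apply: (connect_ind (P := fun v => v != k)) => //.
by move=> x y _ /and3P[].
Qed.

Lemma branch_step k u v w :
  u != k -> v \in branch e k u -> e v w -> w != k -> w \in branch e k u.
Proof.
move=> uk vB vw wk; have vk := branch_avoid uk vB.
move: vB; rewrite !inE => vB; apply: (connect_trans vB); apply: connect1.
by apply/and3P; split.
Qed.

(** A second neighbour v of k in the branch would close a cycle: k, then a simple
path from u to v avoiding k. *)
Lemma branch_root_unique k u v : e k u -> v \in branch e k u -> e v k -> v = u.
Proof.
case: treeT => symE irrE _ acyclic ku; rewrite inE => /connectP[p0 p0P ->].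
case/shortenP: p0P => p pP up _ lastk {p0}.
have uk : u != k by apply: contraTneq ku => ->; rewrite irrE.
have pe : path e u p /\ k \notin u :: p.
  rewrite inE negb_or eq_sym uk /=.
  elim: p u uk pP {ku up lastk} => //= x p IHp u uk.
  case/andP=> /and3P[-> _ xk] /(IHp _ xk)[-> kp].
  by rewrite inE negb_or eq_sym xk.
case: p pP up lastk pe => //= x p _ up lastk [pe kp].
have := acyclic [:: k, u, x & p] isT; rewrite /= ku rcons_path /=.
case/andP: pe => -> ->; rewrite lastk /=.
by move: kp; rewrite /= => ->; rewrite up.
Qed.

Variables (i j : 'I_n).
Hypothesis eij : e i j.

Let ij : i != j := edge_neq eij.
Let ji : j != i. Proof. by rewrite eq_sym. Qed.

Lemma branch_cover u : (u \in branch e j i) || (u \in branch e i j).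
Proof.
case: treeT => _ _ conn _.
apply: (connect_ind (P := fun u => (u \in branch e j i) || (u \in branch e i j))
  _ _ (conn i u)); last by rewrite branch_root.
move=> x y /orP[xB|xB] xy.
- have [->|yj] := eqVneq y j; first by rewrite branch_root orbT.
  by rewrite (branch_step ij xB xy yj).
- have [->|yi] := eqVneq y i; first by rewrite branch_root.
  by rewrite (branch_step ji xB xy yi) orbT.
Qed.

Lemma cross_edge u v :
  u \in branch e j i -> v \notin branch e j i -> e u v -> u = i /\ v = j.
Proof.
move=> uB vB uv.
have vj : v = j by apply/eqP; apply: contraNT vB => /(branch_step ij uB uv).
split=> //; apply: (branch_root_unique (k := j)) => //; rewrite -?vj //.
by rewrite edge_sym // vj.
Qed.

End TreeEdge.

(** * The normalized Laplacian of a tree *)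

Section Laplacian.
Variables (R : realType) (n : nat) (e : rel 'I_n).
Hypotheses (n2 : (2 <= n)%N) (treeT : is_tree e).
Local Notation L := (nlaplacian R e).

Lemma deg_gt0 u : (0 < deg e u)%N.
Proof.
have [v vu] : exists v : 'I_n, v != u.
  apply/existsP; rewrite -negb_forall; apply: contraL n2 => /forallP all_u.
  rewrite -leqNgt -[n]card_ord; apply/card_le1_eqP => x y _ _.
  by rewrite (eqP (all_u x)) (eqP (all_u y)).
case: treeT => _ _ conn _; have /connectP[[|w p]] := conn u v.
  by move=> _ vE; rewrite vE eqxx in vu.
by case/andP=> uw _ _; apply/card_gt0P; exists w; rewrite inE.
Qed.

(** The eigenvector of the normalized Laplacian for the eigenvalue 0. *)
Definition sqrt_deg : 'cV[R]_n := \col_u Num.sqrt (deg e u)%:R.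

Lemma sqrt_deg_gt0 u : 0 < sqrt_deg u 0.
Proof. by rewrite mxE sqrtr_gt0 ltr0n deg_gt0. Qed.

Lemma nlaplacian_sym : L^T = L.
Proof.
by apply/matrixP => u w; rewrite !mxE eq_sym (edge_sym treeT u) mulrC.
Qed.

Lemma nlaplacian_edge u w :
  e u w -> L u w = - (sqrt_deg u 0 * sqrt_deg w 0)^-1.
Proof.
by move=> uw; rewrite !mxE uw (negPf (edge_neq treeT uw)) sqrtrM ?ler0n.
Qed.

Lemma nlaplacian_nonedge u w : u != w -> ~~ e u w -> L u w = 0.
Proof. by move=> uw nuw; rewrite mxE (negPf uw) (negPf nuw). Qed.

Lemma nlaplacian_edge_lt0 u w : e u w -> L u w < 0.
Proof.
by move/nlaplacian_edge->; rewrite oppr_lt0 invr_gt0 mulr_gt0 ?sqrt_deg_gt0.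
Qed.

Lemma nlaplacian_offdiag_le0 : offdiag_le0 L.
Proof.
move=> u w uw; have [/nlaplacian_edge_lt0/ltW //|/nlaplacian_nonedge-> //] :=
  boolP (e u w).
Qed.

Lemma nlaplacian_irreducible : irreducible L.
Proof.
move=> u w; case: treeT => _ _ conn _.
apply: connect_sub (conn u w) => x y xy; apply: connect1 => /=.
exact: nlaplacian_edge_lt0.
Qed.

Lemma nlaplacian_sqrt_deg : L *m sqrt_deg = 0 *: sqrt_deg.
Proof.
apply/colP => u; rewrite scale0r [RHS]mxE mxE (bigD1 u) //= {1}mxE eqxx mul1r.
apply/eqP; rewrite addrC addr_eq0 -eqr_oppLR -sumrN; apply/eqP/esym.
have u0 := sqrt_deg_gt0 u.
rewrite (bigID (e u)) /= [X in _ + X]big1 ?addr0 => [|w /andP[wu nuw]]; last first.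
  by rewrite nlaplacian_nonedge ?mul0r ?oppr0 // eq_sym.
transitivity (\sum_(w in [set w | e u w]) (sqrt_deg u 0)^-1).
  rewrite sumr_const -/(deg e u) -mulr_natl.
  have {1}-> : (deg e u)%:R = sqrt_deg u 0 ^+ 2 :> R.
    by rewrite mxE sqr_sqrtr ?ler0n.
  by field; rewrite gt_eqF.
apply: eq_big => w.
  rewrite inE; have [uw|] := boolP (e u w); rewrite ?andbF //.
  by rewrite eq_sym (edge_neq treeT uw).
rewrite inE => uw; rewrite nlaplacian_edge //; have := sqrt_deg_gt0 w => w0.
by field; rewrite !gt_eqF.
Qed.

Lemma nlaplacian_ge0 : form_ge L 0.
Proof.
exact: (ground_state_ge nlaplacian_sym nlaplacian_offdiag_le0 sqrt_deg_gt0
  nlaplacian_sqrt_deg).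
Qed.

Lemma nlaplacian_isotropic x : dot x (L *m x) = 0 ->
  forall u v, x u 0 / sqrt_deg u 0 = x v 0 / sqrt_deg v 0.
Proof.
move=> Lx; apply: (ground_state_unique nlaplacian_sym nlaplacian_offdiag_le0
  nlaplacian_irreducible sqrt_deg_gt0 nlaplacian_sqrt_deg).
by rewrite mul0r.
Qed.

(** Half of the Courant-Fischer principle. Adding a multiple of w w^T moves the
eigenvalue of w from 0 up to lambda_1. If the least eigenvalue m of the new
matrix were below lambda_1, its eigenvector would be orthogonal to w, so m would
be an eigenvalue of the Laplacian smaller than lambda_1, and it would be positive
because 0 has only the multiples of w as eigenvectors. *)
Lemma lambda1_le_form x :
  dot sqrt_deg x = 0 -> lambda1 R e * dot x x <= dot x (L *m x).
Proof.
move=> wx; set w := sqrt_deg; set la := lambda1 R e.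
have i0 : 'I_n := Ordinal (ltnW n2).
have w0 : w != 0.
  apply: contraTneq (sqrt_deg_gt0 i0) => w0.
  by rewrite -/w w0 mxE ltxx.
have ww := dot_gt0 w0.
pose A := L + (la / dot w w) *: (w *m w^T).
have AE y : A *m y = L *m y + (la / dot w w * dot w y) *: w.
  rewrite mulmxDl -scalemxAl -mulmxA; congr (_ + _).
  rewrite -[RHS]scalerA; congr (_ *: _).
  by apply/colP => u; rewrite mxE big_ord1 -dotE mulrC [RHS]mxE.
have sA : A^T = A.
  by rewrite linearD /= linearZ /= trmx_mul trmxK nlaplacian_sym.
have Lw : L *m w = 0 by rewrite nlaplacian_sqrt_deg scale0r.
have [m [v [v0 Av Age]]] := min_eigenvalue sA (ltnW n2).
have := Age x; rewrite AE wx mulr0 scale0r addr0; apply: le_trans.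
rewrite ler_wpM2r ?dot_ge0 // leNgt; apply/negP => m_la.
have wv : dot w v = 0.
  have := dot_sym w v sA; rewrite Av AE Lw add0r divfK ?gt_eqF //.
  rewrite dotZl dotZr => /eqP; rewrite -subr_eq0 -mulrBl mulf_eq0 subr_eq0.
  by rewrite lt_eqF //= => /eqP.
move: Av; rewrite AE wv mulr0 scale0r addr0 => Lv.
have vv := dot_gt0 v0.
have m0 : 0 <= m.
  by have := nlaplacian_ge0 v; rewrite Lv mul0r dotZr pmulr_lge0.
have [mE|mN0] := eqVneq m 0.
  have Lv0 : dot v (L *m v) = 0 by rewrite Lv dotZr mE mul0r.
  have vE : v = (v i0 0 / w i0 0) *: w.
    apply/colP => u; rewrite [RHS]mxE (nlaplacian_isotropic Lv0 i0 u) divfK //.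
    by rewrite gt_eqF ?sqrt_deg_gt0.
  by move: vv; rewrite {1}vE dotZl wv mulr0 ltxx.
have : la <= m.
  apply: (@second_eigenvalue_le _ _ L 0); last by rewrite lt_def mN0.
  - exact: eigenvalue_col nlaplacian_sym w0 nlaplacian_sqrt_deg.
  - exact: eigenvalue_col nlaplacian_sym v0 Lv.
by rewrite leNgt m_la.
Qed.

End Laplacian.

(** * The inverse of a perturbed bottleneck matrix *)

Section PrincipalSubmatrix.
Variables (R : realType) (m n : nat) (f : 'I_m -> 'I_n).
Hypothesis f_inj : injective f.

(** Extension by zero along f, written with a selection matrix so that passing to
a principal submatrix becomes a congruence. *)
Definition extend (x : 'cV[R]_m) : 'cV[R]_n := (rowsub f 1%:M)^T *m x.

Lemma extend_in x a : extend x (f a) 0 = x a 0.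
Proof.
rewrite mxE (bigD1 a) //= !mxE eqxx mul1r big1 ?addr0 // => b ba.
by rewrite !mxE (inj_eq f_inj) (negPf ba) mul0r.
Qed.

Lemma extend_out x u : (forall a, f a != u) -> extend x u 0 = 0.
Proof.
move=> fu; rewrite mxE big1 // => b _.
by rewrite !mxE (negPf (fu b)) mul0r.
Qed.

Lemma extend_neq0 x : x != 0 -> extend x != 0.
Proof.
apply: contra_neq => x0; apply/colP => a.
by rewrite -extend_in x0 !mxE.
Qed.

Lemma dot_mxsub (A : 'M[R]_n) x :
  dot x (mxsub f f A *m x) = dot (extend x) (A *m extend x).
Proof.
have -> : mxsub f f A = rowsub f 1%:M *m A *m (rowsub f 1%:M)^T.
  by rewrite trmx_mxsub trmx1 -rowsubE mulmx_colsub mulmx1 -mxsubcr.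
by rewrite !dotE /extend trmx_mul trmxK !mulmxA.
Qed.

End PrincipalSubmatrix.

Lemma delta_mx_col (R : realType) n (i : 'I_n) (y : 'cV[R]_n) :
  delta_mx i i *m y = y i 0 *: delta_mx i 0.
Proof.
apply/colP => u; rewrite !mxE (bigD1 i) //= mxE eqxx andbT big1 ?addr0.
  by rewrite mulrC.
by move=> v vi; rewrite mxE (negPf vi) andbF mul0r.
Qed.

Section BranchMatrix.
Variables (R : realType) (n : nat) (e : rel 'I_n) (i j : 'I_n).
Hypotheses (n2 : (2 <= n)%N) (treeT : is_tree e) (eij : e i j).
Local Notation L := (nlaplacian R e).
Local Notation w := (sqrt_deg R e).
Local Notation C := (branch e j i).
Local Notation f := (@enum_val _ (mem C)).

(** The matrix K(t): the Laplacian restricted to the branch, with an additional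
spring of stiffness t at the vertex through which the branch is attached. *)
Definition branch_matrix (t : R) : 'M[R]_#|C| :=
  mxsub f f (L + t *: delta_mx i i).
Local Notation K := branch_matrix.

Let ij : i != j := edge_neq treeT eij.

Let fC a : f a \in C := enum_valP a.

Let fj a : f a != j := branch_avoid ij (fC a).

(** Grounding one vertex kills the kernel, which is spanned by a positive
vector. *)
Lemma nlaplacian_posdef (x : 'cV[R]_n) :
  x j 0 = 0 -> x != 0 -> 0 < dot x (L *m x).
Proof.
move=> xj x0; rewrite lt0r; apply/andP; split.
  apply: contraNneq x0 => /(nlaplacian_isotropic n2 treeT) xw.
  apply/eqP/colP => u; rewrite [RHS]mxE; have /eqP := xw u j; rewrite xj mul0r.
  rewrite mulf_eq0 invr_eq0 => /orP[/eqP //|].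
  by rewrite gt_eqF // sqrt_deg_gt0.
by have := nlaplacian_ge0 n2 treeT x; rewrite mul0r.
Qed.

Lemma grounded_mxsub_posdef m (h : 'I_m -> 'I_n) t (x : 'cV[R]_m) :
  injective h -> (forall a, h a != j) -> 0 <= t -> x != 0 ->
  0 < dot x (mxsub h h (L + t *: delta_mx i i) *m x).
Proof.
move=> h_inj hj t0 x0; rewrite dot_mxsub mulmxDl dotDr -scalemxAl dotZr.
set y := extend h x.
apply: ltr_wpDr; last first.
  by apply: nlaplacian_posdef; rewrite ?extend_out // extend_neq0.
rewrite mulr_ge0 // delta_mx_col dotZr.
suff -> : dot y (delta_mx i 0) = y i 0 by rewrite -expr2 sqr_ge0.
  rewrite /dot (bigD1 i) //= [delta_mx _ _ _ _]mxE !eqxx mulr1.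
  rewrite big1 ?addr0 // => u ui.
by rewrite [delta_mx _ _ _ _]mxE (negPf ui) mulr0.
Qed.

Lemma branch_matrix_posdef t (x : 'cV[R]_#|C|) :
  0 <= t -> x != 0 -> 0 < dot x (K t *m x).
Proof. by apply: grounded_mxsub_posdef => //; exact: enum_val_inj. Qed.

Lemma branch_matrix_sym t : (K t)^T = K t.
Proof.
rewrite trmx_mxsub linearD linearZ /= trmx_delta nlaplacian_sym //.
Qed.

Lemma branch_matrix_offdiag t a b : a != b -> K t a b = L (f a) (f b).
Proof.
move=> ab; rewrite [LHS]mxE [LHS]mxE [X in _ + X]mxE [delta_mx _ _ _ _]mxE.
case: andP => [[/eqP fa /eqP fb]|_]; last by rewrite mulr0 addr0.
by rewrite (enum_val_inj (etrans fa (esym fb))) eqxx in ab.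
Qed.

Lemma branch_matrix_offdiag_le0 t : offdiag_le0 (K t).
Proof.
move=> a b ab; rewrite branch_matrix_offdiag //.
by apply: nlaplacian_offdiag_le0; rewrite ?(inj_eq enum_val_inj).
Qed.

Lemma branch_matrix_irreducible t : irreducible (K t).
Proof.
have reach a :
    connect [rel a b | K t a b < 0] (enum_rank_in (branch_root e j i) i) a.
  have := fC a; rewrite inE => ia; set a0 := enum_rank_in _ i.
  pose P u := exists2 b, f b = u & connect [rel a b | K t a b < 0] a0 b.
  suff [b fb ab] : P (f a) by rewrite -(enum_val_inj fb).
  apply: (connect_ind _ _ ia) => [_ v [b <- a0b] /and3P[bv _ vj]|]; last first.
    by exists a0; rewrite ?connect0 // enum_rankK_in // branch_root.
  have vC := branch_step ij (fC b) bv vj.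
  exists (enum_rank_in vC v); first by rewrite enum_rankK_in.
  apply: connect_trans a0b _; apply: connect1 => /=.
  rewrite branch_matrix_offdiag ?enum_rankK_in ?nlaplacian_edge_lt0 //.
  by rewrite -(inj_eq enum_val_inj) enum_rankK_in // (edge_neq treeT bv).
move=> a b; apply: connect_trans (reach b); rewrite (@sym_connect_sym _ _ _).
  exact: reach.
by move=> x y /=; rewrite -[in LHS]branch_matrix_sym mxE.
Qed.

(** The entries of the Laplacian between C and its complement vanish except at
(i, j). *)
Lemma branch_matrix_mul t (y : 'cV[R]_n) :
  K t *m rowsub f y =
  rowsub f (L *m y + (t * y i 0 - L i j * y j 0) *: delta_mx i 0).
Proof.
apply/colP => a; pose A := L + t *: delta_mx i i.
have -> : (K t *m rowsub f y) a 0 = \sum_(v in C) A (f a) v * y v 0.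
  rewrite mxE (big_enum_val (fun v => A (f a) v * y v 0)).
  by apply: eq_bigr => b _; rewrite !mxE.
have -> : \sum_(v in C) A (f a) v * y v 0 =
    (A *m y) (f a) 0 - \sum_(v | v \notin C) A (f a) v * y v 0.
  by apply/esym/(canLR (addrK _)); rewrite mxE [LHS](bigID (mem C)).
have -> : \sum_(v | v \notin C) A (f a) v * y v 0 =
    L i j * y j 0 * (f a == i)%:R.
  have jC : j \notin C.
    by apply/negP => /(branch_avoid ij); rewrite eqxx.
  have A0 v : v \notin C -> (f a != i) || (v != j) -> A (f a) v = 0.
    move=> vC faj.
    have fav : f a != v by apply: contraNneq vC => <-.
    have -> : A (f a) v = L (f a) v.
      rewrite mxE [X in _ + X]mxE [delta_mx _ _ _ _]mxE.
      case: andP => [[/eqP fa /eqP vi]|]; last by rewrite mulr0 addr0.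
      by rewrite fa vi eqxx in fav.
    apply: (nlaplacian_nonedge R fav); apply: contraL faj => favE.
    by have [-> ->] := cross_edge treeT eij (fC a) vC favE; rewrite !eqxx.
  rewrite (bigD1 j) //= big1 ?addr0 => [|v /andP[vC vj]]; last first.
    by rewrite A0 ?mul0r // vj orbT.
  have [fa|fa] := eqVneq (f a) i; last by rewrite A0 ?fa // mulr0 mul0r.
  rewrite mulr1 fa mxE [X in _ + X]mxE [delta_mx _ _ _ _]mxE.
  by rewrite [j == i]eq_sym (negPf ij) andbF mulr0 addr0.
rewrite mulmxDl -scalemxAl delta_mx_col scalerA [RHS]mxE.
move: (L *m y) => z.
rewrite [X in X - _]mxE [RHS]mxE.
rewrite [X in _ + X - _]mxE [X in _ = _ + X]mxE [delta_mx _ _ _ _]mxE eqxx andbT.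
ring.
Qed.

(** The Laplacian with row and column j deleted is block diagonal with respect to
C and the other vertices, so the block of its inverse inverts the block. *)
Lemma bottleneck_mul : mxsub f f L *m bottleneck R e j C = 1%:M.
Proof.
have Lj_unit : row' j (col' j L) \in unitmx.
  rewrite row'Esub col'Esub -mxsubrc; apply: unitmx_col_kernel => x Lx.
  apply/eqP; apply: contraTT isT => x0.
  have := grounded_mxsub_posdef (@lift_inj _ j) _ (lexx 0) x0.
  rewrite scale0r addr0 Lx -[X in dot x X](scale0r x) dotZr mul0r ltxx.
  by apply=> a; rewrite eq_sym neq_lift.
apply/matrixP => a c; rewrite mxE.
pose F v := if (unlift j v, unlift j (f c)) is (Some u, Some w)
            then invmx (row' j (col' j L)) u w else 0.
transitivity (\sum_(v in C) L (f a) v * F v).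
  rewrite (big_enum_val (fun v => L (f a) v * F v)).
  apply: eq_bigr => b _.
  by rewrite [mxsub _ _ _ _ _]mxE [bottleneck _ _ _ _ _ _]mxE.
transitivity (\sum_v L (f a) v * F v).
  rewrite [RHS](bigID (mem C)) /= [X in _ = _ + X]big1 ?addr0 // => v vC.
  have [->|vj] := eqVneq v j; first by rewrite /F unlift_none mulr0.
  rewrite nlaplacian_nonedge ?mul0r //.
    by apply: contraNneq vC => <-.
  by apply: contra vC => /(branch_step ij (fC a)); apply.
rewrite (bigD1_ord j) //= {1}/F unlift_none mulr0 add0r.
have [a' fa] : exists a', f a = lift j a'.
  by have := fj a; rewrite eq_sym => /unlift_some[a' ->]; exists a'.
have [c' fc] : exists c', f c = lift j c'.
  by have := fj c; rewrite eq_sym => /unlift_some[c' ->]; exists c'.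
transitivity ((row' j (col' j L) *m invmx (row' j (col' j L))) a' c').
  rewrite mxE; apply: eq_bigr => v _.
  by rewrite /F fc !liftK fa [row' _ _ _ _]mxE [col' _ _ _ _]mxE.
rewrite mulmxV // !mxE -(inj_eq enum_val_inj) fa fc.
by rewrite (inj_eq (@lift_inj _ j)).
Qed.

End BranchMatrix.

(** * Eigenvectors of the Laplacian restricted to a branch *)

Section BranchSpectrum.
Variables (R : realType) (n : nat) (e : rel 'I_n) (i j : 'I_n).
Hypotheses (n2 : (2 <= n)%N) (treeT : is_tree e) (eij : e i j).
Local Notation L := (nlaplacian R e).
Local Notation w := (sqrt_deg R e).
Local Notation C := (branch e j i).
Local Notation f := (@enum_val _ (mem C)).
Local Notation K := (branch_matrix e i j).

Let root_mem := branch_root e j i.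
Let a0 := enum_rank_in root_mem i.
Let fa0 : f a0 = i. Proof. exact: enum_rankK_in. Qed.
Let e1 : 'cV[R]_#|C| := rowsub f (delta_mx i 0).
Let dot_e1 (y : 'cV[R]_#|C|) : dot y e1 = y a0 0.
Proof.
rewrite /dot (bigD1 a0) //= [e1 _ _]mxE mxE fa0 !eqxx mulr1.
rewrite big1 ?addr0 // => b ba.
rewrite [e1 _ _]mxE mxE (_ : f b == i = false) ?mulr0 //.
by apply: contraNF ba => /eqP fb; rewrite -(inj_eq enum_val_inj) fa0 fb.
Qed.

Let wi0 : w i 0 != 0. Proof. by rewrite gt_eqF ?sqrt_deg_gt0. Qed.

(** The matrix of the theorem for the branch at j containing i. *)
Definition perturbed_bottleneck (gamma : R) : 'M[R]_#|C| :=
  let D := degree_mx R e C in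
  bottleneck R e j C -
    gamma *: (sqrt_diag D *m const_mx 1 *m (const_mx 1 : 'cV[R]_#|C|)^T
              *m sqrt_diag D).

(** The stiffness for which the matrix K(t) is inverse to the perturbed
bottleneck matrix with parameter gamma. *)
Definition spring (gamma : R) : R := gamma / ((1 - gamma) * w i 0 ^+ 2).

(** Sherman-Morrison: M e_i = w_i w on the branch because L[C] w = e_i / w_i, so
the product with K(t) is 1 plus a multiple of w e_i^T, and the stiffness is
chosen to cancel that multiple. *)
Lemma perturbed_bottleneckE gamma : gamma < 1 ->
  perturbed_bottleneck gamma = invmx (K (spring gamma)).
Proof.
move=> g1; set w1 : 'cV[R]_#|C| := rowsub f w.
have w1E : sqrt_diag (degree_mx R e C) *m const_mx 1 = w1.
  apply/colP => a; rewrite !mxE (bigD1 a) //= !mxE eqxx mulr1n mulr1.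
  rewrite big1 ?addr0 // => b ba.
  by rewrite !mxE eq_sym (negPf ba) mulr0n sqrtr0 mul0r.
have w1TE : (const_mx 1 : 'cV[R]_#|C|)^T *m sqrt_diag (degree_mx R e C) = w1^T.
  rewrite -w1E trmx_mul; congr (_ *m _).
  by rewrite /sqrt_diag map_trmx tr_diag_mx.
rewrite /perturbed_bottleneck -mulmxA w1E w1TE.
set M := bottleneck R e j C; set t := spring gamma.
have LM : M *m mxsub f f L = 1%:M by apply: mulmx1C; apply: bottleneck_mul.
have KE : K t = mxsub f f L + t *: (e1 *m e1^T).
  have -> : e1 *m e1^T = mxsub f f (delta_mx i i).
    apply/matrixP => a b; rewrite !mxE big_ord1 !mxE eqxx !andbT.
    by rewrite -natrM mulnb.
  by apply/matrixP => a b; rewrite !mxE.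
have Lw : mxsub f f L *m w1 = (w i 0)^-1 *: e1.
  have := branch_matrix_mul treeT eij 0 w.
  rewrite /branch_matrix scale0r addr0 => ->.
  rewrite nlaplacian_sqrt_deg // scale0r add0r mul0r sub0r nlaplacian_edge //.
  apply/colP => a; rewrite mxE [LHS]mxE [RHS]mxE [e1 a 0]mxE; congr (_ * _).
  by rewrite mulNr opprK invfM divfK // gt_eqF ?sqrt_deg_gt0.
have Me : M *m e1 = w i 0 *: w1.
  by rewrite -[e1](scalerK (invr_neq0 wi0)) invrK -Lw -scalemxAr mulmxA LM mul1mx.
have wL : w1^T *m mxsub f f L = (w i 0)^-1 *: e1^T.
  have Lsym : (mxsub f f L)^T = mxsub f f L by rewrite trmx_mxsub nlaplacian_sym.
  by rewrite -[mxsub f f L]Lsym -trmx_mul Lw linearZ.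
have we : w1^T *m e1 = (w i 0)%:M.
  by apply/matrixP => a b; rewrite !ord1 -dotE dot_e1 [LHS]mxE fa0 [RHS]mxE.
have NK : (M - gamma *: (w1 *m w1^T)) *m K t = 1%:M.
  rewrite KE mulmxDr !mulmxBl LM -!scalemxAl -!scalemxAr.
  rewrite -[w1 *m w1^T *m mxsub _ _ _]mulmxA wL [M *m _]mulmxA Me.
  rewrite -[w1 *m w1^T *m _]mulmxA [w1^T *m (_ *m _)]mulmxA we mul_scalar_mx.
  rewrite -!scalemxAl -!scalemxAr !scalerA -addrA -scalerBl -scaleNr -scalerDl.
  rewrite [X in X *: _](_ : _ = 0) ?scale0r ?addr0 // /t /spring.
  by field; rewrite wi0 subr_eq0 gt_eqF.
have [Nu Ku] := mulmx1_unit NK.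
by rewrite -[LHS](mulmxK Ku) NK mul1mx.
Qed.

Variables (la : R) (g : 'cV[R]_n).
Hypothesis Lg : L *m g = la *: g.

(** For a vertex of C the eigenvector equation on the tree and the one on the
branch differ only in the terms at i. *)
Lemma branch_matrix_eigen t :
  K t *m rowsub f g =
  la *: rowsub f g + (t * g i 0 - L i j * g j 0) *: e1.
Proof.
rewrite branch_matrix_mul // Lg.
by apply/colP => a; rewrite !mxE.
Qed.

(** Let y be an eigenvector of K(t) for la. Its entry at i is not zero, and the
pairing of y with K(t) g shows that (t g_i - L_ij g_j) y_i = 0. Then g
restricts to an eigenvector for the least eigenvalue. *)
Lemma branch_radius_inv t : 0 <= t ->
  spectral_radius (invmx (K t)) = la^-1 ->
  t * g i 0 = L i j * g j 0 /\
  ((forall u, u \in C -> g u 0 = 0) \/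
   (forall u, u \in C -> 0 < g u 0 * g i 0)).
Proof.
move=> t0 rhoK.
have C0 : (0 < #|C|)%N by apply/card_gt0P; exists i.
have sK := branch_matrix_sym i j treeT t.
have [Kge [y y0 Ky]] := spectral_radius_invmx_inv C0 sK
  (fun x => branch_matrix_posdef n2 treeT eij t0) rhoK.
have oK := @branch_matrix_offdiag_le0 R n e i j n2 treeT t.
have iK := branch_matrix_irreducible n2 treeT eij t.
have yi0 : y a0 0 != 0.
  case: (perron_kernel sK oK iK Kge Ky) => [yE|y_gt0|y_lt0].
  - by rewrite yE eqxx in y0.
  - by rewrite gt_eqF.
  - by rewrite lt_eqF.
have ti : t * g i 0 - L i j * g j 0 = 0.
  have := dot_sym y (rowsub f g) sK.
  rewrite Ky branch_matrix_eigen dotDr dotZl !dotZr dot_e1 -[RHS]addr0.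
  by move=> /addrI/eqP; rewrite mulf_eq0 (negPf yi0) orbF => /eqP.
split; first by apply/eqP; rewrite -subr_eq0 ti.
have Kg : K t *m rowsub f g = la *: rowsub f g.
  by rewrite branch_matrix_eigen ti scale0r addr0.
have gE a : g (f a) 0 = (rowsub f g) a 0 by rewrite mxE.
have giE : g i 0 = (rowsub f g) a0 0 by rewrite mxE fa0.
have onC (P : 'I_n -> Prop) : (forall a, P (f a)) -> forall u, u \in C -> P u.
  by move=> Pf u uC; rewrite -(enum_rankK_in uC uC).
case: (perron_kernel sK oK iK Kge Kg) => [g0|g_gt0|g_lt0].
- by left; apply: onC => a; rewrite gE g0 mxE.
- by right; apply: onC => a; rewrite gE giE mulr_gt0.
- by right; apply: onC => a; rewrite gE giE nmulr_rgt0.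
Qed.

(** The vector g_i g is a nonnegative eigenvector of K(t), hence a positive one,
and it belongs to the least eigenvalue. *)
Lemma branch_radius t : 0 <= t -> t * g i 0 = L i j * g j 0 -> g i 0 != 0 ->
  (forall u, u \in C -> 0 <= g u 0 * g i 0) ->
  spectral_radius (invmx (K t)) = la^-1.
Proof.
move=> t0 ti gi0 g_ge0.
have sK := branch_matrix_sym i j treeT t.
have oK := @branch_matrix_offdiag_le0 R n e i j n2 treeT t.
have iK := branch_matrix_irreducible n2 treeT eij t.
set y : 'cV[R]_#|C| := g i 0 *: rowsub f g.
have Ky : K t *m y = la *: y.
  by rewrite -scalemxAr branch_matrix_eigen ti subrr scale0r addr0 !scalerA mulrC.
have yE a : y a 0 = g (f a) 0 * g i 0 by rewrite !mxE mulrC.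
have y0 : y != 0.
  apply: contraNneq gi0 => y0; have := yE a0; rewrite y0 mxE fa0 => /esym/eqP.
  by rewrite mulf_eq0 orbb.
have y_gt0 := nonneg_eigenvector_gt0 oK iK Ky _ y0.
have {}y_gt0 : forall a, 0 < y a 0.
  by apply: y_gt0 => a; rewrite yE g_ge0 ?enum_valP.
apply: (spectral_radius_invmx sK _ (ground_state_ge sK oK y_gt0 Ky) y0 Ky).
have := branch_matrix_posdef n2 treeT eij t0 y0.
by rewrite Ky dotZr pmulr_lgt0 // dot_gt0.
Qed.

End BranchSpectrum.

(** * Edges along which an eigenvector changes sign *)

(** Suppose that the set S of the vertices of C where g has the sign opposite to
g_i is not empty. Reweight g by a on S, by b outside C and by 0 on the rest of C,
with a and b such that the result x is orthogonal to w and b <> 0. In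
[reweighted_energy] only the edges where the weight changes count. They all
join vertices where g has opposite signs or a zero, and ij is one of them with
strict inequality; so x violates [lambda1_le_form]. *)
Lemma fiedler_sign (R : realType) (n : nat) (e : rel 'I_n) (i j : 'I_n)
    (g : 'cV[R]_n) :
  (2 <= n)%N -> is_tree e -> e i j ->
  nlaplacian R e *m g = lambda1 R e *: g -> g i 0 * g j 0 < 0 ->
  forall u, u \in branch e j i -> 0 <= g u 0 * g i 0.
Proof.
move=> n2 treeT eij Lg gij u0 u0C; rewrite leNgt; apply/negP => gu0.
set C := branch e j i in u0C *; set w := sqrt_deg R e.
have ij := edge_neq treeT eij.
have iC : i \in C := branch_root e j i.
have jC : j \notin C by apply/negP => /(branch_avoid ij); rewrite eqxx.
have gi0 : g i 0 != 0 by apply: contraTneq gij => ->; rewrite mul0r ltxx.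
pose S u := (u \in C) && (g u 0 * g i 0 < 0).
pose a := \sum_(u | u \notin C) w u 0 * g u 0.
pose b := - \sum_(u | S u) w u 0 * g u 0.
have b0 : b != 0.
  rewrite oppr_eq0; suff : (\sum_(u | S u) w u 0 * g u 0) * g i 0 < 0.
    by apply: contraTneq => ->; rewrite mul0r ltxx.
  rewrite mulr_suml.
  rewrite (bigD1 u0) /=; last by rewrite /S u0C gu0.
  apply: ltr_wnDr; first apply: sumr_le0 => u /andP[/andP[_ gu] _].
    by rewrite -mulrA pmulr_rle0 ?sqrt_deg_gt0 // ltW.
  by rewrite -mulrA pmulr_rlt0 ?sqrt_deg_gt0.
pose c u := if S u then a else if u \notin C then b else 0.
set x : 'cV[R]_n := \col_u (c u * g u 0).
have wx : dot w x = 0.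
  have SC u : u \in C -> c u = if S u then a else 0 by move=> uC; rewrite /c uC.
  have SnC u : u \notin C -> c u = b by move=> uC; rewrite /c /S (negPf uC).
  rewrite /dot (bigID (mem C)) /=.
  have -> : \sum_(u in C) w u 0 * x u 0 = a * - b.
    rewrite opprK mulr_sumr (bigID S) /=.
    rewrite [X in _ + X]big1 ?addr0 => [|u /andP[uC Su]].
      apply: eq_big => [u|u /andP[uC Su]]; first by rewrite /S andbA andbb.
      by rewrite [x _ _]mxE SC // Su; ring.
    by rewrite [x _ _]mxE SC // (negPf Su) mul0r mulr0.
  have -> : \sum_(u | u \notin C) w u 0 * x u 0 = a * b.
    rewrite mulr_suml; apply: eq_bigr => u uC.
    by rewrite [x _ _]mxE SnC //; ring.
  ring.
have sL := nlaplacian_sym R treeT.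
have := lambda1_le_form n2 treeT wx.
rewrite -subr_ge0 -(pmulrn_lge0 _ (isT : 0 < 2)%N) -(reweighted_energy _ sL Lg).
apply/negP; rewrite -ltNge.
pose T u v := - nlaplacian R e u v * (g u 0 * g v 0) * (c u - c v) ^+ 2.
have T_le0 u v : T u v <= 0.
  have [<-|uv] := eqVneq u v; first by rewrite /T subrr expr0n mulr0.
  have [euv|/(nlaplacian_nonedge R uv) Luv] := boolP (e u v); last first.
    by rewrite /T Luv oppr0 !mul0r.
  suff [cuv|guv] : c u = c v \/ g u 0 * g v 0 <= 0.
  - by rewrite /T cuv subrr expr0n mulr0.
  - rewrite mulr_le0_ge0 ?sqr_ge0 // pmulr_rle0 // oppr_gt0.
    exact: nlaplacian_edge_lt0.
  have opp y z : y * g i 0 < 0 -> ~~ (z * g i 0 < 0) -> y * z <= 0.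
    rewrite -leNgt => yi zi; rewrite -(pmulr_lle0 _ (_ : 0 < g i 0 ^+ 2)).
      have -> : y * z * g i 0 ^+ 2 = (y * g i 0) * (z * g i 0) by ring.
      by rewrite mulr_le0_ge0 // ltW.
    by rewrite lt0r sqr_ge0 expf_neq0.
  have [uC|uC] := boolP (u \in C); have [vC|vC] := boolP (v \in C).
  - rewrite /c /S uC vC /=; case: ifP => gu; case: ifP => gv; try by left.
      by right; apply: opp; rewrite ?gv.
    by right; rewrite mulrC; apply: opp; rewrite ?gu.
  - by right; have [-> ->] := cross_edge treeT eij uC vC euv; exact: ltW.
  - rewrite (edge_sym treeT) in euv.
    by right; have [-> ->] := cross_edge treeT eij vC uC euv; rewrite mulrC ltW.
  - by left; rewrite /c /S (negPf uC) (negPf vC).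
have Tij : T i j < 0.
  have ci : c i = 0 by rewrite /c /S iC -expr2 ltNge sqr_ge0.
  have cj : c j = b by rewrite /c /S (negPf jC).
  rewrite /T ci cj nmulr_rlt0; last first.
    by rewrite pmulr_rlt0 // oppr_gt0 nlaplacian_edge_lt0.
  by rewrite sub0r sqrrN lt0r sqr_ge0 expf_neq0.
rewrite (bigD1 i) //= (bigD1 j) //= -addrA; apply: ltr_wnDr; last exact: Tij.
apply: ler_wnDr; apply: sumr_le0 => v _; last exact: T_le0.
by apply: sumr_le0 => ? _; exact: T_le0.
Qed.

Theorem theorem7 (R : realType) (n : nat) (e : rel 'I_n) (g : 'cV[R]_n)
    (i j : 'I_n) :
  (2 <= n)%N -> is_tree e -> e i j ->
  eigenfunction (nlaplacian R e) (lambda1 R e) g ->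
  let C1 := branch e j i in
  let C2 := branch e i j in
  let M1 := bottleneck R e j C1 in
  let M2 := bottleneck R e i C2 in
  let D1 := degree_mx R e C1 in
  let D2 := degree_mx R e C2 in
  let one1 : 'cV[R]_#|C1| := const_mx 1 in
  let one2 : 'cV[R]_#|C2| := const_mx 1 in
  (type2 e g /\ characteristic_vertices e g i j) <->
  exists gamma : R,
    [/\ 0 < gamma < 1,
        spectral_radius
          (M1 - gamma *: (sqrt_diag D1 *m one1 *m one1^T *m sqrt_diag D1)) =
        spectral_radius
          (M2 - (1 - gamma) *: (sqrt_diag D2 *m one2 *m one2^T *m sqrt_diag D2))
      & spectral_radius
          (M2 - (1 - gamma) *: (sqrt_diag D2 *m one2 *m one2^T *m sqrt_diag D2)) =
        (lambda1 R e)^-1].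
Proof.
move=> n2 treeT eij [g0 Lg] C1 C2 M1 M2 D1 D2 one1 one2.
have eji : e j i by rewrite edge_sym.
have rho1 gamma : gamma < 1 ->
    spectral_radius
      (M1 - gamma *: (sqrt_diag D1 *m one1 *m one1^T *m sqrt_diag D1)) =
    spectral_radius (invmx (branch_matrix e i j (spring e i gamma))).
  by move=> gamma1; rewrite -perturbed_bottleneckE.
have rho2 gamma : gamma < 1 ->
    spectral_radius
      (M2 - gamma *: (sqrt_diag D2 *m one2 *m one2^T *m sqrt_diag D2)) =
    spectral_radius (invmx (branch_matrix e j i (spring e j gamma))).
  by move=> gamma1; rewrite -perturbed_bottleneckE.
have wi := sqrt_deg_gt0 R n2 treeT i; have wj := sqrt_deg_gt0 R n2 treeT j.
have Lij := nlaplacian_edge R treeT eij; have Lji := nlaplacian_edge R treeT eji.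
have spring_gt0 k gamma : 0 < gamma < 1 -> 0 < spring e k gamma :> R.
  case/andP=> gamma0 gamma1.
  by rewrite divr_gt0 // mulr_gt0 ?subr_gt0 ?exprn_gt0 ?sqrt_deg_gt0.
split=> [[_ [_ mix]]|[gamma [gamma01 r1 r2]]].
- have gij : g i 0 * g j 0 < 0.
    case: mix => u [v []]; rewrite !inE => /orP[] /eqP-> /orP[] /eqP-> u0 v0.
    + by have := lt_trans u0 v0; rewrite ltxx.
    + by rewrite pmulr_rlt0.
    + by rewrite nmulr_rlt0.
    + by have := lt_trans u0 v0; rewrite ltxx.
  have gi0 : g i 0 != 0 by apply: contraTneq gij => ->; rewrite mul0r ltxx.
  have gj0 : g j 0 != 0 by apply: contraTneq gij => ->; rewrite mulr0 ltxx.
  (* The ratio gamma / (1 - gamma) that solves both equations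
     t g_i = L_ij g_j and t' g_j = L_ij g_i. *)
  pose s :=
    - (g i 0 * g j 0 * (sqrt_deg R e i 0 / (sqrt_deg R e j 0 * g i 0 ^+ 2))).
  have s0 : 0 < s.
    rewrite oppr_gt0 nmulr_rlt0 // divr_gt0 // mulr_gt0 //.
    by rewrite lt0r sqr_ge0 expf_neq0.
  have s1 : 0 < 1 + s by rewrite addr_gt0.
  have gamma01 : 0 < s / (1 + s) < 1.
    by rewrite divr_gt0 // ltr_pdivrMr // mul1r ltrDr ltr01.
  have gamma01' : 0 < 1 - s / (1 + s) < 1.
    by case/andP: gamma01 => ? ?; apply/andP; split; lra.
  have ti : spring e i (s / (1 + s)) * g i 0 = nlaplacian R e i j * g j 0.
    have -> : spring e i (s / (1 + s)) = s / sqrt_deg R e i 0 ^+ 2.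
      rewrite /spring; field; rewrite !gt_eqF //=.
      by rewrite [X in 0 < X](_ : _ = 1) //; ring.
    by rewrite Lij /s; field; rewrite gi0 !gt_eqF.
  have tj : spring e j (1 - s / (1 + s)) * g j 0 = nlaplacian R e j i * g i 0.
    have -> : spring e j (1 - s / (1 + s)) = (s * sqrt_deg R e j 0 ^+ 2)^-1.
      by rewrite /spring; field; rewrite !gt_eqF.
    by rewrite Lji /s; field; rewrite gi0 gj0 !gt_eqF.
  have r1 := branch_radius n2 treeT eij Lg (ltW (spring_gt0 i _ gamma01)) ti gi0
    (fiedler_sign n2 treeT eij Lg gij).
  rewrite mulrC in gij.
  have r2 := branch_radius n2 treeT eji Lg
    (ltW (spring_gt0 j _ gamma01')) tj gj0
    (fiedler_sign n2 treeT eji Lg gij).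
  have [_ gamma1] := andP gamma01; have [_ gamma1'] := andP gamma01'.
  exists (s / (1 + s)); split; first exact: gamma01.
    by rewrite (rho1 _ gamma1) (rho2 _ gamma1') r1 r2.
  by rewrite (rho2 _ gamma1').
- have gamma01' : 0 < 1 - gamma < 1.
    by case/andP: gamma01 => ? ?; apply/andP; split; lra.
  have t1 := spring_gt0 i _ gamma01; have t2 := spring_gt0 j _ gamma01'.
  move: r1; rewrite r2 rho1; last by case/andP: gamma01.
  rewrite rho2 in r2; last by case/andP: gamma01'.
  move=> r1.
  have [ti g1] := branch_radius_inv n2 treeT eij Lg (ltW t1) r1.
  have [tj g2] := branch_radius_inv n2 treeT eji Lg (ltW t2) r2.
  have iC := branch_root e j i; have jC := branch_root e i j.
  have Lij0 : nlaplacian R e i j < 0 by exact: nlaplacian_edge_lt0.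
  have Lji0 : nlaplacian R e j i < 0 by exact: nlaplacian_edge_lt0.
  have ij0 : (g i 0 == 0) = (g j 0 == 0).
    apply/eqP/eqP => gk0; [move: ti | move: tj]; rewrite gk0 mulr0.
      by move/esym/eqP; rewrite mulf_eq0 lt_eqF //= => /eqP.
    by move/esym/eqP; rewrite mulf_eq0 lt_eqF //= => /eqP.
  have gi0 : g i 0 != 0.
    apply: contra g0 => gi0; have gj0 := gi0; rewrite ij0 in gj0.
    apply/eqP/colP => u; rewrite mxE.
    case/orP: (branch_cover treeT eij u) => uC.
      by case: g1 => [-> //|/(_ _ uC)]; rewrite (eqP gi0) mulr0 ltxx.
    by case: g2 => [-> //|/(_ _ uC)]; rewrite (eqP gj0) mulr0 ltxx.
  have gj0 : g j 0 != 0 by rewrite -ij0.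
  have {}g1 : forall u, u \in C1 -> 0 < g u 0 * g i 0.
    by case: g1 => // /(_ i iC) gi; rewrite gi eqxx in gi0.
  have {}g2 : forall u, u \in C2 -> 0 < g u 0 * g j 0.
    by case: g2 => // /(_ j jC) gj; rewrite gj eqxx in gj0.
  have gij : g i 0 * g j 0 < 0.
    rewrite -(nmulr_rgt0 _ Lij0) mulrCA -ti mulrCA mulr_gt0 // -expr2.
    by rewrite lt0r sqr_ge0 expf_neq0.
  (* Each branch carries one sign, so the ends of a mixed edge lie in different
     branches, and ij is the only edge between these. *)
  have mixed_ends u v :
      e u v -> 0 < g u 0 -> g v 0 < 0 -> [set u; v] = [set i; j].
    move=> euv gu gv.
    have apart (C : {set 'I_n}) k : (forall u, u \in C -> 0 < g u 0 * g k 0) ->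
        u \in C -> v \in C -> False.
      move=> gC /gC; rewrite pmulr_rgt0 // => gk /gC.
      by rewrite nmulr_rgt0 // ltNge ltW.
    have [uC|uC] := boolP (u \in C1); have [vC|vC] := boolP (v \in C1).
    - by case: (apart C1 i g1 uC vC).
    - by have [-> ->] := cross_edge treeT eij uC vC euv.
    - rewrite (edge_sym treeT) in euv.
      by have [-> ->] := cross_edge treeT eij vC uC euv; rewrite finset.setUC.
    - have := branch_cover treeT eij u; have := branch_cover treeT eij v.
      rewrite (negPf uC) (negPf vC) /= => uC2 vC2.
      by case: (apart C2 j g2 vC2 uC2).
  have mix : mixed g [set i; j].
    move: gij; case: (ltrgt0P (g i 0)) gi0 => // gi _ gij.
      by exists i, j; rewrite !inE !eqxx orbT; split=> //;
        rewrite pmulr_rlt0 in gij.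
    by exists j, i; rewrite !inE !eqxx orbT; split=> //;
      rewrite nmulr_rlt0 in gij.
  have block_ij : [set i; j] \in blocks e.
    by apply/imsetP; exists (i, j); rewrite ?inE.
  split; last by split.
  exists [set i; j]; split; first by split.
  move=> _ [/imsetP[[u v] euv ->] [x [y []]]]; rewrite inE /= in euv.
  rewrite !inE => /orP[] /eqP-> /orP[] /eqP-> gx gy.
  - by have := lt_trans gx gy; rewrite ltxx.
  - by rewrite (mixed_ends _ _ euv).
  - by rewrite [RHS]finset.setUC (mixed_ends v u) // (edge_sym treeT).
  - by have := lt_trans gx gy; rewrite ltxx.
Qed.
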